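(* Given a graph $G$ along with a decomposition tree of $G$ of rank-width $\mathsf{rw}$, the \textsc{Maximum Even Subgraph} problem can be solved in time $\mathcal{O}^*(2^{3\,\mathsf{rw}})$.
   Context: All graphs are finite, simple and undirected. A graph is called even if every vertex has even degree. The \textsc{Maximum Even Subgraph} problem is: given a graph $G$, determine the maximum number of vertices of an even induced subgraph of $G$. A decomposition tree of $G$ is a pair $(T,\delta)$ where $T$ is a full binary tree (rooted, every non-leaf node has two children) and $\delta$ is a bijection between the leaves of $T$ and $V(G)$. For a node $w$ of $T$, let $V_w\subseteq V(G)$ be the set of vertices corresponding via $\delta$ to the leaves of the subtree rooted at $w$, and $\overline{V_w}=V(G)\setminus V_w$. The rank-width of $(T,\delta)$ is the maximum over all nodes $w$ of $T$ of the rank over $\mathrm{GF}(2)$ of the $V_w\times\overline{V_w}$ adjacency matrix of the bipartite graph $G[V_w,\overline{V_w}]$ (edges of $G$ between $V_w$ and $\overline{V_w}$). The notation $\mathcal{O}^*$ hides factors polynomial in the input size. *)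

(* Defs.v *)
From mathcomp Require Import all_boot all_algebra.

Set Implicit Arguments.
Unset Strict Implicit.
Unset Printing Implicit Defensive.

Record sgraph (V : finType) := SGraph {
  adj :> rel V;
  adj_sym : symmetric adj;
  adj_irrefl : irreflexive adj
}.

Definition degree (V : finType) (G : sgraph V) (v : V) : nat :=
  #|[set u | G v u]|.

Definition even_graph (V : finType) (G : sgraph V) : bool :=
  [forall v, ~~ odd (degree G v)].

Section Induced.
Variables (V : finType) (G : sgraph V) (S : {set V}).

Definition induced_adj : rel {x | x \in S} := fun x y => G (val x) (val y).

Lemma induced_sym : symmetric induced_adj.
Proof. by move=> x y; apply: adj_sym. Qed.

Lemma induced_irrefl : irreflexive induced_adj.
Proof. by move=> x; apply: adj_irrefl. Qed.

Definition induced : sgraph {x | x \in S} := SGraph induced_sym induced_irrefl.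

End Induced.

(* The empty induced subgraph is even, so the maximum ranges over a nonempty
   family. *)
Definition max_even_subgraph (V : finType) (G : sgraph V) : nat :=
  \max_(S : {set V} | even_graph (induced G S)) #|S|.

(* A pair (T, delta) is a full binary tree with leaves labelled by vertices;
   bijectivity of delta is [is_decomposition_tree]. *)
Inductive leaf_tree (V : Type) :=
  | Leaf of V
  | Node of leaf_tree V & leaf_tree V.

Fixpoint leaves (V : Type) (T : leaf_tree V) : seq V :=
  match T with
  | Leaf v => [:: v]
  | Node l r => leaves l ++ leaves r
  end.

(* A node w of T is identified with the subtree rooted at w. *)
Fixpoint subtrees (V : Type) (T : leaf_tree V) : seq (leaf_tree V) :=
  T :: match T with
       | Leaf _ => [::]
       | Node l r => subtrees l ++ subtrees r
       end.

Definition is_decomposition_tree (V : finType) (T : leaf_tree V) : Prop :=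
  uniq (leaves T) /\ (forall v : V, v \in leaves T).

Definition cut_matrix (V : finType) (G : sgraph V) (A : {set V}) :
    'M['F_2]_(#|A|, #|~: A|) :=
  (\matrix_(i, j) (G (enum_val i) (enum_val j))%:R)%R.

Definition rank_width (V : finType) (G : sgraph V) (T : leaf_tree V) : nat :=
  \max_(w <- subtrees T) \rank (cut_matrix G [set v in leaves w]).

(* Model of computation: first-order Lisp on S-expressions, with unary
   recursive functions.  Every primitive is a bounded number of pointer
   operations (in particular the only test is "is this a pair"; there is no
   unit-cost comparison of S-expressions and no arithmetic), so t steps of a
   fixed program take O(t) steps on a unit-cost RAM.  Conversely t RAM steps on
   words of O(log t) bits take O(t polylog t) steps here, memory being kept in
   a balanced tree.  Bounds of the form 2 ^ (3 * rw) * poly(input size), with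
   rw at most the number of vertices, thus hold in both models or in neither. *)
Inductive sexp := Nil | Cons of sexp & sexp.

Definition hd (s : sexp) : sexp := if s is Cons a _ then a else Nil.
Definition tl (s : sexp) : sexp := if s is Cons _ b then b else Nil.

Fixpoint sexp_size (s : sexp) : nat :=
  if s is Cons a b then (sexp_size a + sexp_size b).+1 else 1.

(* Variables are de Bruijn indices into the local environment; [ECall f e]
   calls the f-th function of the program. *)
Inductive expr :=
  | EVar of nat
  | ENil
  | ECons of expr & expr
  | EHd of expr
  | ETl of expr
  | EIf of expr & expr & expr
  | ELet of expr & expr
  | ECall of nat & expr.

(* The list of function bodies; in each body the argument is [EVar 0]. *)
Definition program := seq expr.

(* [eval p env e v t]: in [env], [e] evaluates to [v] in [t] steps.
   Unbound variables denote [Nil] and undefined functions return [Nil]. *)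
Inductive eval (p : program) : seq sexp -> expr -> sexp -> nat -> Prop :=
  | eval_var env x : eval p env (EVar x) (nth Nil env x) 1
  | eval_nil env : eval p env ENil Nil 1
  | eval_cons env e1 e2 v1 v2 t1 t2 :
      eval p env e1 v1 t1 -> eval p env e2 v2 t2 ->
      eval p env (ECons e1 e2) (Cons v1 v2) (t1 + t2).+1
  | eval_hd env e v t :
      eval p env e v t -> eval p env (EHd e) (hd v) t.+1
  | eval_tl env e v t :
      eval p env e v t -> eval p env (ETl e) (tl v) t.+1
  | eval_if_cons env e e1 e2 a b v t t1 :
      eval p env e (Cons a b) t -> eval p env e1 v t1 ->
      eval p env (EIf e e1 e2) v (t + t1).+1
  | eval_if_nil env e e1 e2 v t t2 :
      eval p env e Nil t -> eval p env e2 v t2 ->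
      eval p env (EIf e e1 e2) v (t + t2).+1
  | eval_let env e1 e2 v1 v2 t1 t2 :
      eval p env e1 v1 t1 -> eval p (v1 :: env) e2 v2 t2 ->
      eval p env (ELet e1 e2) v2 (t1 + t2).+1
  | eval_call env f e v r t1 t2 :
      eval p env e v t1 -> eval p [:: v] (nth ENil p f) r t2 ->
      eval p env (ECall f e) r (t1 + t2).+1.

Lemma eval_deterministic (p : program) env e v t v' t' :
  eval p env e v t -> eval p env e v' t' -> v = v' /\ t = t'.
Proof.
move=> H; elim: H v' t' => {env e v t}; intros;
  match goal with H : eval _ _ _ ?v' ?t' |- _ = ?v' /\ _ = ?t' =>
    inversion H; subst end;
  repeat match goal with
  | IH : forall v t, eval _ ?env ?e v t -> _, H : eval _ ?env ?e _ _ |- _ =>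
    let E1 := fresh in let E2 := fresh in
    case: (IH _ _ H) => E1 E2; clear IH; try discriminate E1;
    try (injection E1; clear E1; intros); subst
  end; by [].
Qed.

(* Function 0 is the main function. *)
Definition computes_in (p : program) (input output : sexp) (t : nat) : Prop :=
  eval p [:: input] (nth ENil p 0) output t.

Definition encode_seq (s : seq sexp) : sexp := foldr Cons Nil s.

Definition encode_bool (b : bool) : sexp := if b then Cons Nil Nil else Nil.

(* Unary.  Only used for numbers at most #|V|, so that the encoding of an
   instance still has size polynomial in #|V|. *)
Definition encode_nat (n : nat) : sexp := encode_seq (nseq n Nil).

Definition encode_graph (V : finType) (G : sgraph V) : sexp :=
  encode_seq [seq encode_seq [seq encode_bool (G u v) | v <- enum V]
             | u <- enum V].

Fixpoint encode_tree (V : finType) (T : leaf_tree V) : sexp :=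
  match T with
  | Leaf v => Cons (encode_bool false) (encode_nat (enum_rank v))
  | Node l r => Cons (encode_bool true) (Cons (encode_tree l) (encode_tree r))
  end.

Definition encode_instance (V : finType) (G : sgraph V) (T : leaf_tree V) :
    sexp :=
  Cons (encode_graph G) (encode_tree T).

(* Main.v *)
From mathcomp Require Import all_boot all_algebra zify.
Require Import Defs.

(* For a node of the decomposition tree with vertex set W, call the sum over
   GF(2) of the adjacency rows of a set S of vertices its trace; a part S of a
   solution inside W interacts with the rest of the graph only through the
   restriction a of its trace to the complement of W, and the part of the
   solution outside W is seen by S only through the restriction b of its trace
   to W.  Both a and b range over spaces of dimension at most rw.  Each node
   gets a table of the largest S for every pair (a, b).  At an inner node with
   children W1 and W2, the triple (b, a1, a2) determines
   a = (a1 + a2) outside W, b1 = (b + a2) on W1 and b2 = (b + a1) on W2, so the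
   table of W is filled by looping over at most 2 ^ (3 * rw) triples.  The
   tables are tries, so an access takes linear time, and the spaces are listed
   by adding generators one at a time. *)

Set Implicit Arguments.
Unset Strict Implicit.
Unset Printing Implicit Defensive.

(** * Symbolic execution with cost bounds *)

(** Only an upper bound on the cost is kept, so that bounds compose through the rules and can be
    rounded to closed forms. *)
Definition evalb p env e v T := exists2 t, eval p env e v t & t <= T.

Section CostRules.
Variable p : program.

Lemma evalb_var env x : evalb p env (EVar x) (nth Nil env x) 1.
Proof. by exists 1 => //; exact: eval_var. Qed.

Lemma evalb_nil env : evalb p env ENil Nil 1.
Proof. by exists 1 => //; exact: eval_nil. Qed.

Lemma evalb_cons env e1 e2 v1 v2 T1 T2 :
  evalb p env e1 v1 T1 -> evalb p env e2 v2 T2 ->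
  evalb p env (ECons e1 e2) (Cons v1 v2) (T1 + T2).+1.
Proof.
move=> [t1 h1 l1] [t2 h2 l2]; exists (t1 + t2).+1; first exact: eval_cons.
by rewrite ltnS leq_add.
Qed.

Lemma evalb_hd env e v T : evalb p env e v T -> evalb p env (EHd e) (hd v) T.+1.
Proof. by move=> [t h l]; exists t.+1 => //; exact: eval_hd. Qed.

Lemma evalb_tl env e v T : evalb p env e v T -> evalb p env (ETl e) (tl v) T.+1.
Proof. by move=> [t h l]; exists t.+1 => //; exact: eval_tl. Qed.

Lemma evalb_if env e e1 e2 v v' T T' :
  evalb p env e v T ->
  evalb p env (if v is Cons _ _ then e1 else e2) v' T' ->
  evalb p env (EIf e e1 e2) v' (T + T').+1.
Proof.
move=> [t h l] [t' h' l']; exists (t + t').+1; last by rewrite ltnS leq_add.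
case: v h h' => [|a b] h h'; [exact: eval_if_nil h h'|exact: eval_if_cons h h'].
Qed.

Lemma evalb_let env e1 e2 v1 v2 T1 T2 :
  evalb p env e1 v1 T1 -> evalb p (v1 :: env) e2 v2 T2 ->
  evalb p env (ELet e1 e2) v2 (T1 + T2).+1.
Proof.
move=> [t1 h1 l1] [t2 h2 l2]; exists (t1 + t2).+1; first exact: eval_let h1 h2.
by rewrite ltnS leq_add.
Qed.

Lemma evalb_weaken env e v v' T T' :
  evalb p env e v T -> v = v' -> T <= T' -> evalb p env e v' T'.
Proof. by move=> [t h l] <- l'; exists t => //; exact: leq_trans l'. Qed.

End CostRules.

Notation arg := (EVar 0).
Notation call2 f a b := (ECall f (ECons a b)).
Notation call3 f a b c := (ECall f (ECons a (ECons b c))).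
Notation etrue := (ECons ENil ENil).

(** * The program *)

(* [fold_body f g] is the body of a function [f] mapping
   [(env . (acc . l))] to the left fold over [l] of the function [g], which is
   called on [(env . (acc . x))]. *)
Definition fold_body f g :=
  EIf (ETl (ETl arg))
    (call3 f (EHd arg)
             (call3 g (EHd arg) (EHd (ETl arg)) (EHd (ETl (ETl arg))))
             (ETl (ETl (ETl arg))))
    (EHd (ETl arg)).

Definition map2_body f (op : expr -> expr -> expr) :=
  EIf (EHd arg)
    (ECons (op (EHd (EHd arg)) (EHd (ETl arg)))
           (call2 f (ETl (EHd arg)) (ETl (ETl arg))))
    ENil.

Definition fXor := 1.
Definition fDiff := 2.
Definition fAnd := 3.
Definition fCompl := 4.
Definition fAppend := 5.
Definition fMax := 6.
Definition fLookup := 7.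
Definition fUpdate := 8.
Definition fNth := 9.
Definition fSetBit := 10.
Definition fGens := 11.
Definition fEq := 12.
Definition fMem := 13.
Definition fShiftFold := 14.
Definition fShift := 15.
Definition fSpanFold := 16.
Definition fSpan := 17.
Definition fCutSpan := 18.
Definition fComb := 19.
Definition fLoop2 := 20.
Definition fStep2 := 21.
Definition fLoop1 := 22.
Definition fStep1 := 23.
Definition fLoop0 := 24.
Definition fStep0 := 25.
Definition fSolve := 26.

Definition xor_body :=
  map2_body fXor (fun a b => EIf a (EIf b ENil etrue) (EIf b etrue ENil)).
Definition diff_body :=
  map2_body fDiff (fun a b => EIf a (EIf b ENil etrue) ENil).
Definition and_body :=
  map2_body fAnd (fun a b => EIf a (EIf b etrue ENil) ENil).
Definition compl_body :=
  map2_body fCompl (fun a b => EIf a ENil etrue).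

(* Also adds unary numbers. *)
Definition append_body :=
  EIf (EHd arg)
    (ECons (EHd (EHd arg)) (call2 fAppend (ETl (EHd arg)) (ETl arg)))
    (ETl arg).

Definition max_body :=
  EIf (EHd arg)
    (EIf (ETl arg)
       (ECons ENil (call2 fMax (ETl (EHd arg)) (ETl (ETl arg))))
       (EHd arg))
    (ETl arg).

(* Argument: (trie . key) *)
Definition lookup_body :=
  EIf (ETl arg)
    (EIf (EHd (ETl arg))
       (call2 fLookup (ETl (EHd arg)) (ETl (ETl arg)))
       (call2 fLookup (EHd (EHd arg)) (ETl (ETl arg))))
    (EHd arg).

(* Argument: (trie . (key . value)).  The entry at the key is replaced by its
   maximum with the value. *)
Definition update_body :=
  EIf (EHd (ETl arg))
    (EIf (EHd (EHd (ETl arg)))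
       (ECons (EHd (EHd arg))
          (call3 fUpdate (ETl (EHd arg)) (ETl (EHd (ETl arg))) (ETl (ETl arg))))
       (ECons
          (call3 fUpdate (EHd (EHd arg)) (ETl (EHd (ETl arg))) (ETl (ETl arg)))
          (ETl (EHd arg))))
    (call2 fMax (EHd arg) (ETl (ETl arg))).

(* Argument: (list . index) *)
Definition nth_body :=
  EIf (ETl arg)
    (call2 fNth (ETl (EHd arg)) (ETl (ETl arg)))
    (EHd (EHd arg)).

(* Argument: (bits . index) *)
Definition setbit_body :=
  EIf (ETl arg)
    (ECons (EHd (EHd arg)) (call2 fSetBit (ETl (EHd arg)) (ETl (ETl arg))))
    (ECons etrue (ETl (EHd arg))).

(* Argument: (rows . (X . X')).  The bits X', aligned with the rows, select some
   of them; X is removed from these. *)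
Definition gens_body :=
  EIf (EHd arg)
    (EIf (EHd (ETl (ETl arg)))
       (ECons
          (call2 fDiff (EHd (EHd arg)) (EHd (ETl arg)))
          (call3 fGens (ETl (EHd arg)) (EHd (ETl arg)) (ETl (ETl (ETl arg)))))
       (call3 fGens (ETl (EHd arg)) (EHd (ETl arg)) (ETl (ETl (ETl arg)))))
    ENil.

Definition eq_body :=
  EIf (EHd arg)
    (EIf (EHd (EHd arg))
       (EIf (EHd (ETl arg))
          (call2 fEq (ETl (EHd arg)) (ETl (ETl arg))) ENil)
       (EIf (EHd (ETl arg))
          ENil (call2 fEq (ETl (EHd arg)) (ETl (ETl arg)))))
    etrue.

Definition mem_body :=
  EIf (ETl arg)
    (EIf (call2 fEq (EHd arg) (EHd (ETl arg)))
       etrue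
       (call2 fMem (EHd arg) (ETl (ETl arg))))
    ENil.

Definition shift_body :=
  ECons (call2 fXor (EHd arg) (ETl (ETl arg))) (EHd (ETl arg)).

(* Argument: (_ . (L . x)), where L lists a whole subspace, to which the
   generator x is added. *)
Definition span_body :=
  EIf (call2 fMem (ETl (ETl arg)) (EHd (ETl arg)))
    (EHd (ETl arg))
    (call3 fShiftFold (ETl (ETl arg)) (EHd (ETl arg)) (EHd (ETl arg))).

(* Argument: (rows . X) *)
Definition cutspan_body :=
  call3 fSpanFold ENil
    (ECons (call2 fDiff (ETl arg) (ETl arg)) ENil)
    (call3 fGens (EHd arg) (ETl arg) (ETl arg)).

Definition comb_body :=
  EIf (EHd arg)
    (EIf (ETl arg) (call2 fAppend (ETl (EHd arg)) (ETl arg)) ENil)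
    ENil.

(* The three nested loops over b, a1 and a2 share the environment
   ((W . (W1 . W2)) . ((t1 . t2) . (R1 . R2))), to which the inner loops
   prepend b and a1. *)
Definition step2_body :=
  let e := EHd (EHd (EHd arg)) in
  let b := ETl (EHd (EHd arg)) in
  let a1 := ETl (EHd arg) in
  let a2 := ETl (ETl arg) in
  call3 fUpdate (EHd (ETl arg))
    (call2 fAppend (call2 fDiff (call2 fXor a1 a2) (EHd (EHd e))) b)
    (call2 fComb
       (call2 fLookup (EHd (EHd (ETl e)))
          (call2 fAppend a1
             (call2 fAnd (call2 fXor b a2) (EHd (ETl (EHd e))))))
       (call2 fLookup (ETl (EHd (ETl e)))
          (call2 fAppend a2
             (call2 fAnd (call2 fXor b a1) (ETl (ETl (EHd e))))))).

Definition step1_body :=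
  call3 fLoop2 (ECons (EHd arg) (ETl (ETl arg))) (EHd (ETl arg))
    (ETl (ETl (ETl (EHd (EHd arg))))).

Definition step0_body :=
  call3 fLoop1 (ECons (EHd arg) (ETl (ETl arg))) (EHd (ETl arg))
    (EHd (ETl (ETl (EHd arg)))).

(* Argument: (rows . tree); result: (W . table). *)
Definition solve_body :=
  EIf (EHd (ETl arg))
    (ELet (call2 fSolve (EHd arg) (EHd (ETl (ETl arg))))
    (ELet (call2 fSolve (EHd (EVar 1)) (ETl (ETl (ETl (EVar 1)))))
    (ELet (call2 fXor (EHd (EVar 1)) (EHd (EVar 0)))
      (ECons (EVar 0)
         (call3 fLoop0
            (ECons
               (ECons (EVar 0) (ECons (EHd (EVar 2)) (EHd (EVar 1))))
               (ECons
                  (ECons (ETl (EVar 2)) (ETl (EVar 1)))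
                  (ECons (call2 fCutSpan (EHd (EVar 3)) (EHd (EVar 2)))
                         (call2 fCutSpan (EHd (EVar 3)) (EHd (EVar 1))))))
            ENil
            (call2 fCutSpan (EHd (EVar 3))
               (call2 fCompl (EVar 0) (EVar 0))))))))
    (ELet (call2 fNth (EHd arg) (ETl (ETl arg)))
    (ELet (call2 fDiff (EVar 0) (EVar 0))
    (ELet (call2 fSetBit (EVar 0) (ETl (ETl (EVar 2))))
      (ECons (EVar 0)
        (call3 fUpdate
           (call3 fUpdate
              (call3 fUpdate ENil
                 (call2 fAppend (EVar 1) (EVar 1)) (ECons ENil ENil))
              (call2 fAppend (EVar 1) (EVar 0)) (ECons ENil ENil))
           (call2 fAppend (EVar 2) (EVar 1))
           (ECons ENil (ECons ENil ENil))))))).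

(** At the root both traces are zero, and [EVar 0] is the zero vector for the key; the final [ETl]
    removes the one added to every feasible table entry. *)
Definition main_body :=
  ELet (ECall fSolve arg)
  (ELet (call2 fDiff (EHd (EVar 0)) (EHd (EVar 0)))
    (ETl (call2 fLookup (ETl (EVar 1)) (call2 fAppend (EVar 0) (EVar 0))))).

Definition prog : program :=
  [:: main_body; xor_body; diff_body; and_body; compl_body; append_body;
      max_body; lookup_body; update_body; nth_body; setbit_body; gens_body;
      eq_body; mem_body; fold_body fShiftFold fShift; shift_body;
      fold_body fSpanFold fSpan; span_body; cutspan_body; comb_body;
      fold_body fLoop2 fStep2; step2_body; fold_body fLoop1 fStep1; step1_body;
      fold_body fLoop0 fStep0; step0_body; solve_body].

(** * Correctness and running time of the subroutines *)

Definition runs f x v T := evalb prog [:: x] (nth ENil prog f) v T.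

Lemma evalb_call env f e v r T1 T2 :
  evalb prog env e v T1 -> runs f v r T2 ->
  evalb prog env (ECall f e) r (T1 + T2).+1.
Proof.
move=> [t1 h1 l1] [t2 h2 l2]; exists (t1 + t2).+1; first exact: eval_call h1 h2.
by rewrite ltnS leq_add.
Qed.

Lemma runs_weaken f x v v' T T' :
  runs f x v T -> v = v' -> T <= T' -> runs f x v' T'.
Proof. exact: evalb_weaken. Qed.

#[local] Create HintDb runs_db.

(** Values and costs are found by unification. A branch is chosen by reducing only the tested value
    to head normal form, so that the rest of the goal stays folded. *)
Ltac ev_step :=
  lazymatch goal with
  | |- evalb _ _ (EVar _) _ _ => eapply evalb_var
  | |- evalb _ _ ENil _ _ => eapply evalb_nil
  | |- evalb _ _ (ECons _ _) _ _ => eapply evalb_cons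
  | |- evalb _ _ (EHd _) _ _ => eapply evalb_hd
  | |- evalb _ _ (ETl _) _ _ => eapply evalb_tl
  | |- evalb _ _ (EIf _ _ _) _ _ => eapply evalb_if
  | |- evalb _ _ (ELet _ _) _ _ => eapply evalb_let; cbn [hd tl nth]
  | |- evalb _ _ (ECall _ _) _ _ => eapply evalb_call
  | |- evalb ?p ?env (match ?s with Nil => ?e2 | Cons _ _ => ?e1 end) ?v ?T =>
      let s' := eval hnf in s in
      lazymatch s' with
      | Nil => change (evalb p env e2 v T)
      | Cons _ _ => change (evalb p env e1 v T)
      end
  | |- evalb _ _ _ _ _ => eassumption
  | |- runs _ _ _ _ => cbn [hd tl nth];
      solve [eauto 2 with runs_db nocore]
  end.
Ltac ev := repeat ev_step.
Ltac ev_body b := apply: (@evalb_weaken prog _ b); first (rewrite /b; ev).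

Section Fold.
Variables (A : Type) (X : eqType) (encA : A -> sexp) (encX : X -> sexp).
Variables (f g : nat) (env : sexp) (step : A -> X -> A) (P : A -> Prop).
Hypothesis f_body : nth ENil prog f = fold_body f g.

(** The invariant [P] allows [T] to bound the step only on accumulators that actually occur. The
    summand 30 pays for one round of the loop itself, and the successor for the final test. *)
Lemma fold_runs T l a :
  (forall a x, P a -> x \in l ->
     runs g (Cons env (Cons (encA a) (encX x))) (encA (step a x)) T
     /\ P (step a x)) ->
  P a ->
  runs f (Cons env (Cons (encA a) (encode_seq (map encX l))))
    (encA (foldl step a l)) ((size l).+1 * (T + 30))
  /\ P (foldl step a l).
Proof.
elim: l a => [|x l IH] a Hg Pa.
  split=> //; rewrite /runs f_body /fold_body /=.
  apply: evalb_weaken.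
  - by ev.
  - by [].
  - by rewrite /=; lia.
have [Hx Px] := Hg a x Pa (mem_head _ _).
have [|IH1 IH2] := IH (step a x) _ Px.
  by move=> a' x' Pa' Hx'; apply: Hg => //; rewrite inE Hx' orbT.
split=> //; rewrite /runs f_body /fold_body /=.
apply: evalb_weaken.
- by ev.
- by [].
- by rewrite /=; lia.
Qed.

End Fold.

(** * Lists, unary numbers and tries *)

Definition encb (s : seq bool) := encode_seq (map encode_bool s).

Lemma append_runs s y :
  runs fAppend (Cons (encode_seq s) y) (foldr Cons y s) (20 * (size s).+1).
Proof.
elim: s => [|x s IH]; ev_body append_body => //=.
by lia.
Qed.

#[local] Hint Resolve append_runs : runs_db.

Fixpoint smax (s t : sexp) : sexp :=
  match s, t with
  | Cons _ s', Cons _ t' => Cons Nil (smax s' t')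
  | Nil, _ => t
  | _, Nil => s
  end.

Lemma smax_nat i j : smax (encode_nat i) (encode_nat j) = encode_nat (maxn i j).
Proof.
elim: i j => [|i IH] [|j] //=; rewrite maxnSS /encode_nat /=; congr Cons.
exact: IH.
Qed.

(** The recursion ends with the shorter operand, so the bound depends on the new value alone and
    nothing has to be known about the stored entry [s]. *)
Lemma max_runs s j :
  runs fMax (Cons s (encode_nat j)) (smax s (encode_nat j)) (20 * j.+1).
Proof.
elim: j s => [|j IH] [|x s]; ev_body max_body => //=; lia.
Qed.
#[local] Hint Resolve max_runs : runs_db.

Fixpoint tlook (t : sexp) (k : seq bool) : sexp :=
  if k is b :: k' then tlook (if b then tl t else hd t) k' else t.

Fixpoint tupd (t : sexp) (k : seq bool) (v : sexp) : sexp :=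
  match k with
  | true :: k' => Cons (hd t) (tupd (tl t) k' v)
  | false :: k' => Cons (tupd (hd t) k' v) (tl t)
  | [::] => smax t v
  end.

(** Keys of equal length are never proper prefixes of each other, so an update cannot disturb
    another entry. *)
Lemma tlook_upd t k v k' : size k = size k' ->
  tlook (tupd t k v) k' = if k == k' then smax (tlook t k') v else tlook t k'.
Proof.
elim: k k' t => [|b k IH] [|b' k'] t //= [Hk].
by case: b b' => [] []; rewrite /= ?IH ?eqseq_cons //=.
Qed.

(** [Nil] is at once the empty trie and the number 0: [hd] and [tl] fix it, so an absent entry reads
    as infeasible. *)
Lemma tlook_Nil k : tlook Nil k = Nil.
Proof. by elim: k => // -[]. Qed.

Lemma lookup_runs t k :
  runs fLookup (Cons t (encb k)) (tlook t k) (30 * (size k).+1).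
Proof.
elim: k t => [|b k IH] t; last case: b; ev_body lookup_body => //=; lia.
Qed.
#[local] Hint Resolve lookup_runs : runs_db.

Lemma update_runs t k j :
  runs fUpdate (Cons t (Cons (encb k) (encode_nat j)))
    (tupd t k (encode_nat j)) (40 * (size k).+1 + 20 * j.+1).
Proof.
elim: k t => [|b k IH] t; last case: b; ev_body update_body => //=; lia.
Qed.
#[local] Hint Resolve update_runs : runs_db.

Lemma nth_runs s i :
  runs fNth (Cons (encode_seq s) (encode_nat i)) (nth Nil s i) (20 * i.+1).
Proof.
elim: i s => [|i IH] [|x s]; last 1 first.
- by ev_body nth_body => //=; lia.
- by ev_body nth_body.
- by ev_body nth_body.
- have := IH [::]; rewrite /= nth_nil => IH0.
  by ev_body nth_body => //=; lia.
Qed.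
#[local] Hint Resolve nth_runs : runs_db.

Lemma setbit_runs s i : i < size s ->
  runs fSetBit (Cons (encb s) (encode_nat i)) (encb (set_nth false s i true))
    (20 * i.+1).
Proof.
elim: s i => [|b s IH] [|i] //= Hi; first by ev_body setbit_body.
by have IHi := IH i Hi; ev_body setbit_body => //=; lia.
Qed.
#[local] Hint Resolve setbit_runs : runs_db.

(* Table entries are 0 if there is no partial solution, and otherwise one more
   than the maximal size of one. *)
Definition comb i j := if (i == 0) || (j == 0) then 0 else i.-1 + j.

Lemma comb_runs i j :
  runs fComb (Cons (encode_nat i) (encode_nat j))
    (encode_nat (comb i j)) (20 * i + 20).
Proof.
case: i => [|i]; first by ev_body comb_body.
case: j => [|j]; first by ev_body comb_body => //=; lia.
have A : runs fAppend (Cons (encode_nat i) (encode_nat j.+1))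
    (encode_nat (i + j.+1)) (20 * i.+1).
  by apply: runs_weaken (append_runs _ _) _ _;
    rewrite ?size_nseq // /encode_nat nseqD /encode_seq foldr_cat.
by ev_body comb_body => //=; lia.
Qed.
#[local] Hint Resolve comb_runs : runs_db.

(** * Vertex sets as vectors over GF(2), and their spans *)

Section Vectors.
Variable V : finType.
Implicit Types (A B S W : {set V}) (L : seq {set V}).
Notation N := #|V|.+1.

(* Sets of vertices are vectors over GF(2), and [symd] is their sum. *)
Definition symd A B : {set V} := [set v | (v \in A) (+) (v \in B)].
Definition bits A : seq bool := [seq v \in A | v <- enum V].
Definition enc A : sexp := encb (bits A).
Definition key A B : seq bool := bits A ++ bits B.

Lemma size_bits A : size (bits A) = #|V|.
Proof. by rewrite size_map -cardE. Qed.

Lemma size_key A B : size (key A B) = 2 * #|V|.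
Proof. by rewrite size_cat !size_bits mul2n addnn. Qed.

Lemma bits_inj : injective bits.
Proof.
move=> A B /eq_in_map eAB; apply/setP => v.
by apply: eAB; rewrite mem_enum.
Qed.

Lemma eq_key A B A' B' : (key A B == key A' B') = (A == A') && (B == B').
Proof. by rewrite eqseq_cat ?size_bits // !(inj_eq bits_inj). Qed.

(** On every path through [op] each operand is evaluated at most once, which justifies a cost of the
    form [Ta + Tb + 10]. *)
Lemma map2_runs f op (o : bool -> bool -> bool) A B :
  nth ENil prog f = map2_body f op ->
  (forall env ea eb a b Ta Tb,
     evalb prog env ea (encode_bool a) Ta ->
     evalb prog env eb (encode_bool b) Tb ->
     evalb prog env (op ea eb) (encode_bool (o a b)) (Ta + Tb + 10)) ->
  runs f (Cons (enc A) (enc B)) (enc [set v | o (v \in A) (v \in B)]) (40 * N).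
Proof.
move=> f_body op_runs.
have -> : enc [set v | o (v \in A) (v \in B)] =
    encb [seq o (v \in A) (v \in B) | v <- enum V].
  by congr encb; apply: eq_map => v; rewrite inE.
rewrite /enc /bits cardE.
elim: (enum V) => [|v l IH]; rewrite /runs f_body /map2_body /=;
  apply: evalb_weaken.
- by ev.
- by [].
- by [].
- ev; apply: (op_runs _ _ _ (v \in A) (v \in B) 3 3);
    by apply: evalb_weaken; [ev|..].
- by [].
- by rewrite /=; lia.
Qed.

Lemma xor_runs A B :
  runs fXor (Cons (enc A) (enc B)) (enc (symd A B)) (40 * N).
Proof.
apply: map2_runs => // env ea eb a b Ta Tb Ha Hb.
by case: a b Ha Hb => [] [] Ha Hb;
  (apply: evalb_weaken; [ev|by []|lia]).
Qed.

Lemma diff_runs A B :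
  runs fDiff (Cons (enc A) (enc B)) (enc (A :\: B)) (40 * N).
Proof.
have -> : A :\: B = [set v | (v \in A) && (v \notin B)].
  by apply/setP => v; rewrite !inE andbC.
apply: (map2_runs (o := fun a b => a && ~~ b)) => // env ea eb a b Ta Tb Ha Hb.
by case: a b Ha Hb => [] [] Ha Hb;
  (apply: evalb_weaken; [ev|by []|lia]).
Qed.

Lemma and_runs A B :
  runs fAnd (Cons (enc A) (enc B)) (enc (A :&: B)) (40 * N).
Proof.
have -> : A :&: B = [set v | (v \in A) && (v \in B)].
  by apply/setP => v; rewrite !inE.
apply: (map2_runs (o := andb)) => // env ea eb a b Ta Tb Ha Hb.
by case: a b Ha Hb => [] [] Ha Hb;
  (apply: evalb_weaken; [ev|by []|lia]).
Qed.

Lemma compl_runs A B :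
  runs fCompl (Cons (enc A) (enc B)) (enc (~: A)) (40 * N).
Proof.
have -> : ~: A = [set v | v \notin A] by apply/setP => v; rewrite !inE.
apply: (map2_runs (o := fun a b => ~~ a)) => // env ea eb a b Ta Tb Ha Hb.
by case: a Ha => [] Ha;
  (apply: evalb_weaken; [ev|by []|lia]).
Qed.

#[local] Hint Resolve xor_runs diff_runs and_runs compl_runs : runs_db.

Lemma key_runs A B :
  runs fAppend (Cons (enc A) (enc B)) (encb (key A B)) (20 * N).
Proof.
apply: runs_weaken (append_runs _ _) _ _.
  by rewrite /encb /key map_cat /encode_seq foldr_cat.
by rewrite size_map size_bits.
Qed.

Lemma eq_runs A B :
  runs fEq (Cons (enc A) (enc B)) (encode_bool (A == B)) (30 * N).
Proof.
rewrite -(inj_eq bits_inj) /enc /bits cardE.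
elim: (enum V) => [|v l IH]; ev_body eq_body => //=.
have := IH; rewrite eqseq_cons.
by case: (v \in A); case: (v \in B) => /= IH'; apply: evalb_weaken; try ev;
  rewrite //=.
by lia.
Qed.

#[local] Hint Resolve key_runs eq_runs : runs_db.

Definition encl L : sexp := encode_seq (map enc L).

Lemma mem_runs A L :
  runs fMem (Cons (enc A) (encl L)) (encode_bool (A \in L))
    (60 * N * (size L).+1).
Proof.
elim: L => [|B L IH]; first by ev_body mem_body => //=; lia.
rewrite inE; have := eq_runs A B; case: eqP => _ eqAB.
  by ev_body mem_body => //=; lia.
by ev_body mem_body => //=; lia.
Qed.

(** Adjoins the coset of [L] by [A]. Starting the accumulator at [L] itself saves a separate
    concatenation. *)
Definition shift A L := foldl (fun L' B => symd A B :: L') L L.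

Lemma shiftE A L : shift A L = rev (map (symd A) L) ++ L.
Proof.
rewrite /shift; elim: L {1 4}L => [|B l IH] L' //=.
by rewrite IH rev_cons cat_rcons.
Qed.

Lemma shift_runs A L L' :
  runs fShiftFold (Cons (enc A) (Cons (encl L) (encl L')))
    (encl (foldl (fun L B => symd A B :: L) L L')) (100 * N * (size L').+1).
Proof.
have [|//|H _] := @fold_runs _ _ encl enc fShiftFold fShift (enc A)
  (fun L B => symd A B :: L) xpredT erefl (60 * N) L' L.
  by move=> L1 B _ _; split=> //; ev_body shift_body => //; lia.
by apply: runs_weaken H _ _ => //; rewrite mulnC leq_mul2r; lia.
Qed.
#[local] Hint Resolve mem_runs shift_runs : runs_db.

(** The membership test keeps the list free of repetitions, so its length stays below the
    cardinality of the space; the running time rests on this. *)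
Definition add_gen L A := if A \in L then L else shift A L.
Definition span L := foldl add_gen [:: set0] L.

Definition symd_closed (U : {pred {set V}}) :=
  forall A B, A \in U -> B \in U -> symd A B \in U.

Lemma symdC A B : symd A B = symd B A.
Proof. by apply/setP => v; rewrite !inE addbC. Qed.

Lemma symdA A B S : symd A (symd B S) = symd (symd A B) S.
Proof. by apply/setP => v; rewrite !inE addbA. Qed.

Lemma symdK A B : symd A (symd A B) = B.
Proof. by apply/setP => v; rewrite !inE addKb. Qed.

Lemma symd0 A : symd A set0 = A.
Proof. by apply/setP => v; rewrite !inE addbF. Qed.

Definition subspace_seq L := [/\ uniq L, set0 \in L & symd_closed (mem L)].

Lemma mem_shift A L B : (B \in shift A L) = (symd A B \in L) || (B \in L).
Proof.
rewrite shiftE mem_cat mem_rev; congr orb.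
apply/mapP/idP => [[S SL ->]|H]; first by rewrite symdK.
by exists (symd A B) => //; rewrite symdK.
Qed.

Lemma add_gen_mem L A : subspace_seq L -> A \in add_gen L A.
Proof.
move=> [_ L0 _]; rewrite /add_gen; case: ifP => // _.
rewrite mem_shift; have -> : symd A A = set0; last by rewrite L0.
by apply/setP => v; rewrite !inE addbb.
Qed.

Lemma add_gen_sub L A : {subset L <= add_gen L A}.
Proof.
by move=> B BL; rewrite /add_gen; case: ifP => // _; rewrite mem_shift BL orbT.
Qed.

(** If the coset by [A] met [L], then [A] would be a sum of two elements of [L]. Sums within one
    half fall into [L], mixed sums into the coset. *)
Lemma add_gen_subspace L A : subspace_seq L -> subspace_seq (add_gen L A).
Proof.
move=> HL; have [uL L0 cL] := HL; rewrite /add_gen; case: ifPn => // AL.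
split.
- rewrite shiftE cat_uniq rev_uniq uL map_inj_uniq ?uL; last first.
    by move=> B S /(congr1 (symd A)); rewrite !symdK.
  rewrite andbT; apply/hasPn => B BL; rewrite mem_rev.
  apply: contra AL => /mapP[S SL eB].
  have -> : A = symd B S by rewrite eB symdC (symdC A) symdK.
  exact: cL.
- by rewrite mem_shift L0 orbT.
- move=> B S; rewrite /= !mem_shift => /orP[] HB /orP[] HS; apply/orP.
  + right; have := cL _ _ HB HS.
    by rewrite (symdC A B) -symdA symdK.
  + by left; rewrite symdA; apply: cL.
  + by left; rewrite symdA (symdC A B) -symdA; apply: cL.
  + by right; apply: cL.
Qed.

Lemma add_gen_in L A (U : {set {set V}}) : symd_closed (mem U) ->
  {subset L <= U} -> A \in U -> {subset add_gen L A <= U}.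
Proof.
move=> cU LU AU B; rewrite /add_gen; case: ifP => [_ /LU //|_].
rewrite mem_shift => /orP[/LU H|/LU //].
by rewrite -(symdK A B); apply: cU.
Qed.

Lemma subspace_set0 : subspace_seq [:: set0].
Proof.
split; rewrite ?inE // => A B; rewrite /= !inE => /eqP-> /eqP->.
by rewrite symd0.
Qed.

Lemma span_subspace L : subspace_seq (span L).
Proof.
rewrite /span; elim: L [:: set0] subspace_set0 => [|A L IH] L' HL' //=.
exact/IH/add_gen_subspace.
Qed.

Lemma span_mem L : {subset L <= span L}.
Proof.
rewrite /span => A; elim: L [:: set0] subspace_set0 => [|B L IH] L' HL' //=.
rewrite inE => /orP[/eqP->|AL]; last exact/IH/AL/add_gen_subspace.
have := add_gen_mem B HL'; elim: L {IH HL'} (add_gen L' B) => //= S L IH L1 H.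
exact/IH/add_gen_sub.
Qed.

Lemma span_in L (U : {set {set V}}) : set0 \in U -> symd_closed (mem U) ->
  {subset L <= U} -> {subset span L <= U}.
Proof.
rewrite /span => U0 cU; have : {subset [:: set0] <= U}.
  by move=> A; rewrite inE => /eqP->.
elim: L [:: set0] => [|A L IH] L' HL' //= LU.
apply: IH; last by move=> B BL; apply: LU; rewrite inE BL orbT.
by apply: add_gen_in => //; apply: LU; rewrite inE eqxx.
Qed.

Lemma subspace_size L (U : {set {set V}}) :
  uniq L -> {subset L <= U} -> size L <= #|U|.
Proof.
by move=> uL LU; rewrite cardE uniq_leq_size // => A /LU; rewrite mem_enum.
Qed.

(** The ambient space [U] bounds the length of every intermediate list, hence the cost of the
    membership scan and of the coset for each generator. *)
Lemma span_runs L (U : {set {set V}}) :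
  set0 \in U -> symd_closed (mem U) -> {subset L <= U} ->
  runs fSpanFold (Cons Nil (Cons (encl [:: set0]) (encl L))) (encl (span L))
    ((size L).+1 * (500 * N * #|U|)).
Proof.
move=> U0 cU LU.
have U_gt0 : 0 < #|U| by apply/card_gt0P; exists set0.
pose P L' := subspace_seq L' /\ {subset L' <= U}.
have [||H _] := @fold_runs _ _ encl enc fSpanFold fSpan Nil
  add_gen P erefl (400 * N * #|U|) L [:: set0].
- move=> L' A [HL' L'U] /LU AU; split; last first.
    by split; [apply: add_gen_subspace|apply: add_gen_in].
  have sz : size L' <= #|U| by apply: subspace_size L'U; case: HL'.
  have sN : N * size L' <= N * #|U| by rewrite leq_mul2l sz.
  have s1 : N <= N * #|U| by rewrite leq_pmulr.
  rewrite /add_gen; have := mem_runs A L'; case: ifP => _ Hm.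
    ev_body span_body => //=; clear Hm; move: sN s1.
    by move: #|V| (size L') #|U| => n s u; lia.
  ev_body span_body => //=; clear Hm; move: sN s1.
  by move: #|V| (size L') #|U| => n s u; lia.
- by split; [apply: subspace_set0|move=> A; rewrite inE => /eqP->].
- apply: runs_weaken H _ _ => //; rewrite leq_mul2l.
  have s1 : N <= N * #|U| by rewrite leq_pmulr.
  by lia.
Qed.
#[local] Hint Resolve span_runs : runs_db.

End Vectors.

#[local] Hint Resolve xor_runs diff_runs and_runs compl_runs key_runs eq_runs
  mem_runs shift_runs span_runs : runs_db.

(** * Row spaces of cuts *)

Section CutSpace.
Variables (V : finType) (G : sgraph V).
Implicit Types (A B S W X : {set V}).
Notation N := #|V|.+1.

Definition nbr u : {set V} := [set v | G u v].

(* The sum over GF(2) of the adjacency rows of [A]. *)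
Definition odd_nbr A : {set V} := [set v | odd #|[set u in A | G u v]|].

(* The row space of the adjacency matrix between [W] and its complement. *)
Definition cut_space W : {set {set V}} :=
  [set odd_nbr X :\: W | X in powerset W].

Lemma odd_card_symd A B : odd #|symd A B| = odd #|A| (+) odd #|B|.
Proof.
have -> : symd A B = (A :\: B) :|: (B :\: A).
  by apply/setP => v; rewrite !inE; do 2 case: (v \in _).
rewrite cardsU.
have -> : (A :\: B) :&: (B :\: A) = set0.
  by apply/setP => v; rewrite !inE; do 2 case: (v \in _).
rewrite cards0 subn0 oddD -(cardsID B A) -(cardsID A B) !oddD setIC.
by case: (odd _); case: (odd _); case: (odd _).
Qed.

Lemma odd_nbr_symd A B : odd_nbr (symd A B) = symd (odd_nbr A) (odd_nbr B).
Proof.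
apply/setP => v; rewrite !inE -odd_card_symd; congr (odd #|pred_of_set _|).
by apply/setP => u; rewrite !inE; case: (G u v); rewrite ?andbT ?andbF.
Qed.

Lemma odd_nbr0 : odd_nbr set0 = set0.
Proof.
apply/setP => v; rewrite !inE.
by under eq_finset do rewrite inE; rewrite cards0.
Qed.

Lemma odd_nbr1 u : odd_nbr [set u] = nbr u.
Proof.
apply/setP => v; rewrite !inE.
have -> : [set w in [set u] | G w v] = if G u v then [set u] else set0.
  apply/setP => w; rewrite !inE; case: eqP => [->|].
    by case: (G u v); rewrite ?inE ?eqxx.
  by move=> wu; case: (G u v); rewrite ?inE //=; apply/esym/eqP.
by case: (G u v); rewrite ?cards1 ?cards0.
Qed.

Lemma symdD A B W : symd (A :\: W) (B :\: W) = symd A B :\: W.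
Proof. by apply/setP => v; rewrite !inE; case: (v \in W). Qed.

Lemma symd_sub A B W : A \subset W -> B \subset W -> symd A B \subset W.
Proof.
move=> /subsetP AW /subsetP BW; apply/subsetP => v; rewrite inE.
by case: (boolP (v \in A)) => [/AW//|_] /= /BW.
Qed.

Lemma cut_space0 W : set0 \in cut_space W.
Proof.
by apply/imsetP; exists set0; rewrite ?inE ?sub0set // odd_nbr0 set0D.
Qed.

Lemma cut_space_closed W : symd_closed (mem (cut_space W)).
Proof.
move=> _ _ /imsetP[A AW ->] /imsetP[B BW ->]; rewrite symdD -odd_nbr_symd.
by apply: imset_f; rewrite powersetE symd_sub -?powersetE.
Qed.

Definition cut_gens W := [seq nbr u :\: W | u <- enum V & u \in W].
Definition cut_seq W := span (cut_gens W).

Lemma cut_gens_in W : {subset cut_gens W <= cut_space W}.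
Proof.
move=> A /mapP[u]; rewrite mem_filter => /andP[uW _] ->.
by rewrite -odd_nbr1; apply: imset_f; rewrite powersetE sub1set.
Qed.

Lemma mem_cut_seq W : cut_seq W =i cut_space W.
Proof.
move=> A; apply/idP/idP.
  apply: span_in; [exact: cut_space0|exact: cut_space_closed|].
  exact: cut_gens_in.
have [_ s0 sC] := span_subspace (cut_gens W).
case/imsetP => X; rewrite powersetE => XW ->.
(* Induction on the size of [X]: removing a vertex [u] subtracts its row, which is one of the
   generators. *)
elim: {X}#|X| {-2}X (erefl #|X|) XW => [|k IH] X cX XW.
  by rewrite (cards0_eq cX) odd_nbr0 set0D.
have /card_gt0P[u uX] : 0 < #|X| by rewrite cX.
have -> : X = symd (X :\ u) [set u].
  apply/setP => v; rewrite !inE; case: eqP => [->|]; rewrite ?uX //=.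
  by rewrite addbF.
rewrite odd_nbr_symd odd_nbr1 -symdD; apply: sC.
  apply: IH; last exact: subset_trans (subsetDl _ _) XW.
  by apply/eqP; rewrite -eqSS -cX (cardsD1 u X) uX.
apply: span_mem; apply/mapP; exists u => //.
by rewrite mem_filter mem_enum (subsetP XW).
Qed.

Lemma size_cut_seq W : size (cut_seq W) <= #|cut_space W|.
Proof.
apply: subspace_size; first by case: (span_subspace (cut_gens W)).
by move=> A; rewrite mem_cut_seq.
Qed.

Lemma encode_graphE : encode_graph G = encl [seq nbr u | u <- enum V].
Proof.
rewrite /encode_graph /encl -map_comp; congr encode_seq; apply: eq_map => u /=.
rewrite /enc /encb /bits -map_comp; congr encode_seq; apply: eq_map => v /=.
by rewrite inE.
Qed.

Lemma gens_runs W (l : seq V) :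
  runs fGens (Cons (encl [seq nbr u | u <- l])
                   (Cons (enc W) (encb [seq u \in W | u <- l])))
    (encl [seq nbr u :\: W | u <- l & u \in W]) (100 * N * (size l).+1).
Proof.
elim: l => [|u l IH]; first by ev_body gens_body => //; lia.
have Hd := diff_runs (nbr u) W.
move: IH; rewrite /=; case: (u \in W) => /= IH.
  ev_body gens_body => //=.
  by move: #|V| (size l) => n s; lia.
ev_body gens_body => //=.
by move: #|V| (size l) => n s; lia.
Qed.

Lemma cutspan_runs W :
  runs fCutSpan (Cons (encode_graph G) (enc W)) (encl (cut_seq W))
    (800 * (N * N * #|cut_space W|)).
Proof.
rewrite encode_graphE.
have Hg : runs fGens (Cons (encl [seq nbr u | u <- enum V])
                   (Cons (enc W) (enc W))) (encl (cut_gens W)) (100 * N * N).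
  by have := gens_runs W (enum V); rewrite -cardE.
have Hs := span_runs (cut_space0 W) (@cut_space_closed W) (@cut_gens_in W).
(* The program obtains the zero vector of the right length as the difference of [W] with itself. *)
have E : encl [:: set0 : {set V}] = Cons (enc (W :\: W)) Nil by rewrite setDv.
rewrite E in Hs.
ev_body cutspan_body => //=.
have : size (cut_gens W) <= #|V|.
  by rewrite size_map size_filter (leq_trans (count_size _ _)) // -cardE.
have : 0 < #|cut_space W| by apply/card_gt0P; exists set0; exact: cut_space0.
clear; move: #|V| (size _) #|cut_space W| => n g u u_gt0 gn.
have h1 : n.+1 * n.+1 <= n.+1 * n.+1 * u by rewrite leq_pmulr.
have h2 : n.+1 <= n.+1 * n.+1 by rewrite leq_pmulr.
have h3 : g.+1 * (500 * n.+1 * u) <= n.+1 * (500 * n.+1 * u).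
  by rewrite leq_mul2r ltnS gn orbT.
by lia.
Qed.

End CutSpace.

(** * Cut spaces against the rank of the cut matrix *)

Section CutRank.
Import GRing.Theory.
Local Open Scope ring_scope.

(** Through the factorization of [M] into [col_base] and [row_base], every image vector comes from a
    row vector of length [\rank M]. *)
Lemma card_mulmx_image m n (M : 'M['F_2]_(m, n)) :
  (#|[set x *m M | x : 'rV_m]| <= 2 ^ \rank M)%N.
Proof.
have -> : (2 ^ \rank M = #|{: 'rV['F_2]_(\rank M)}|)%N.
  by rewrite card_mx card_Fp // mul1n.
apply: leq_trans (leq_imset_card (mulmxr (row_base M)) predT).
apply: subset_leq_card; apply/subsetP => y /imsetP[x _ yE].
rewrite yE; apply/imsetP; exists (x *m col_base M) => //=.
by rewrite -mulmxA mulmx_base.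
Qed.

Variables (V : finType) (G : sgraph V).

Lemma natF2_eq0 k : ((k%:R : 'F_2) == 0) = ~~ odd k.
Proof. by rewrite -dvdn2 (dvdn_pcharf (pchar_Fp _)). Qed.

(** The complement enters through an equation so that the transposed cut matrix fits as well, where
    [B] is only propositionally the double complement. *)
Lemma card_cut_space_le (A B : {set V}) (M : 'M['F_2]_(#|A|, #|B|)) :
  (forall i j, M i j = (G (enum_val i) (enum_val j))%:R) -> B = ~: A ->
  (#|cut_space G A| <= 2 ^ \rank M)%N.
Proof.
move=> ME defB; apply: leq_trans (card_mulmx_image M).
pose h (r : 'rV['F_2]_#|B|) : {set V} :=
  [set v | [exists j, (enum_val j == v) && (r 0 j != 0)]].
apply: leq_trans (leq_imset_card h (mem [set x *m M | x : 'rV_#|A|])).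
apply: subset_leq_card; apply/subsetP => Y /imsetP[X].
rewrite powersetE => XA YE.
(* The indicator vector of [X] is multiplied by [M]; its product has as entries the parities of the
   neighbour counts. *)
rewrite YE; apply/imsetP; exists ((\row_i (enum_val i \in X)%:R) *m M).
  by apply: imset_f.
have E j : ((\row_i (enum_val i \in X)%:R) *m M) 0 j =
    (#|[set u in X | G u (enum_val j)]|)%:R.
  pose F u : 'F_2 := ((u \in X) && G u (enum_val j))%:R.
  rewrite !mxE -[#|[set _ in X | _]|]sum1_card natr_sum.
  rewrite (eq_bigr (fun i => F (enum_val i))).
    rewrite -(big_enum_val F) /= big_mkcond [RHS]big_mkcond /=.
    apply: eq_bigr => u _; rewrite /F !inE.
    have := subsetP XA u; case: (u \in X) => [->//|_] /=.
      by case: (G _ _).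
    by case: ifP.
  move=> i _; rewrite !mxE ME /F.
  by case: (_ \in X); case: (G _ _); rewrite ?mulr0 ?mul0r ?mulr1.
have BA v : (v \in B) = (v \notin A) by rewrite defB inE.
apply/setP => v; rewrite !inE; apply/andP/existsP.
  move=> [vA oddv]; have vB : v \in B by rewrite BA.
  exists (enum_rank_in vB v); rewrite E natF2_eq0 negbK.
  by rewrite enum_rankK_in // eqxx.
move=> [j /andP[/eqP <-]]; rewrite E natF2_eq0 negbK => ->; split=> //.
by rewrite -BA; exact: enum_valP.
Qed.

Lemma card_cut_space (A : {set V}) :
  (#|cut_space G A| <= 2 ^ \rank (cut_matrix G A))%N.
Proof. by apply: card_cut_space_le => // i j; rewrite mxE. Qed.

Lemma card_cut_spaceC (A : {set V}) :
  (#|cut_space G (~: A)| <= 2 ^ \rank (cut_matrix G A))%N.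
Proof.
rewrite -mxrank_tr; apply: card_cut_space_le; last by rewrite setCK.
by move=> i j; rewrite !mxE adj_sym.
Qed.

End CutRank.

(** * The tables *)

Section DynamicProgram.
Variables (V : finType) (G : sgraph V).
Implicit Types (A B S W X a b : {set V}).
Notation N := #|V|.+1.
Notation nb := (odd_nbr G).

(* [S] is a partial solution inside [W] whose adjacency rows sum to [a] outside
   of [W], and which becomes even once vertices outside of [W] whose adjacency
   rows sum to [b] on [W] are added. *)
Definition partial W a b S :=
  [&& S \subset W, nb S :\: W == a & S :&: nb S == S :&: b].

Definition best W a b := \max_(S | partial W a b S) #|S|.+1.

Lemma best_le W a b : best W a b <= N.
Proof. by apply/bigmax_leqP => S _; rewrite ltnS max_card. Qed.

Lemma best_attained W a b : 0 < best W a b ->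
  exists2 S, partial W a b S & best W a b = #|S|.+1.
Proof.
rewrite /best => best_gt0; case: (pickP (partial W a b)) => [S0 HS0|none].
  have [|S HS ->] := @eq_bigmax_cond _ (partial W a b) (fun S => #|S|.+1).
    by apply/card_gt0P; exists S0.
  by exists S.
by rewrite big_pred0 in best_gt0.
Qed.

Lemma best_ge W a b S : partial W a b S -> #|S| < best W a b.
Proof. by move=> HS; apply: (bigmax_sup S). Qed.

Lemma setI_eqP S A B :
  reflect (forall v, v \in S -> (v \in A) = (v \in B)) (S :&: A == S :&: B).
Proof.
apply: (iffP eqP) => [/setP eAB v vS|eAB].
  by have := eAB v; rewrite !inE vS.
by apply/setP => v; rewrite !inE; case: (boolP (v \in S)) => // /eAB.
Qed.

Lemma symd_disjoint A B : [disjoint A & B] -> symd A B = A :|: B.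
Proof.
move=> dAB; apply/setP => v; rewrite !inE.
case: (boolP (v \in A)) => [vA|//]; by rewrite (disjointFr dAB vA).
Qed.

(** * Joining the tables of two children *)

Section Node.
Variables W1 W2 : {set V}.
Hypothesis dW : [disjoint W1 & W2].
Notation W := (symd W1 W2).
Let defW : W = W1 :|: W2. Proof. exact: symd_disjoint. Qed.

(** A vertex of [S1] lies outside [W2], so the contribution of [S2] to its parity is read off [a2].
    Moving it to the other side turns the requirement [b] into [b + a2]; symmetrically for [S2]. *)
Lemma partial_union S1 S2 a1 a2 b : S1 \subset W1 -> S2 \subset W2 ->
  nb S1 :\: W1 = a1 -> nb S2 :\: W2 = a2 ->
  partial W (symd a1 a2 :\: W) b (S1 :|: S2) =
  partial W1 a1 (symd b a2 :&: W1) S1 && partial W2 a2 (symd b a1 :&: W2) S2.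
Proof.
move=> S1W S2W <- <-; rewrite /partial S1W S2W !eqxx /=.
have -> /= : S1 :|: S2 \subset W by rewrite defW setUSS.
have dS : [disjoint S1 & S2] by apply: disjointWl S1W _; apply: disjointWr dW.
have nbS : nb (S1 :|: S2) = symd (nb S1) (nb S2).
  by rewrite -symd_disjoint // odd_nbr_symd.
have in1 v : v \in S1 -> (v \in W1) * ((v \in W2) = false).
  by move=> /(subsetP S1W) vW; rewrite vW (disjointFr dW vW).
have in2 v : v \in S2 -> (v \in W2) * ((v \in W1) = false).
  by move=> /(subsetP S2W) vW; rewrite vW (disjointFl dW vW).
have -> /= : nb (S1 :|: S2) :\: W == symd (nb S1 :\: W1) (nb S2 :\: W2) :\: W.
  rewrite nbS defW; apply/eqP/setP => v; rewrite !inE.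
  by case: (v \in W1); case: (v \in W2).
rewrite nbS; apply/setI_eqP/andP => [H|[/setI_eqP H1 /setI_eqP H2] v].
  split; apply/setI_eqP => v vS.
    have := H v; rewrite !inE vS /= !in1 // => /(_ isT) <-.
    by rewrite andbT addbK.
  have := H v; rewrite !inE vS orbT /= !in2 // => /(_ isT) <-.
  by rewrite andbT [X in X (+) _]addbC addbK.
rewrite inE => /orP[] vS.
  have := H1 v vS; rewrite !inE !in1 //= andbT => ->.
  by rewrite addbK.
have := H2 v vS; rewrite !inE !in2 //= andbT => ->.
by rewrite addbC addbK.
Qed.

(** Tables are only correct for [b] in the cut space of the complement, so the keys looked up at the
    children must stay there. The sum of the two preimages avoids [W1] and has the required
    trace. *)
Lemma cut_space_shift a b : a \in cut_space G W2 -> b \in cut_space G (~: W) ->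
  symd b a :&: W1 \in cut_space G (~: W1).
Proof.
move=> /imsetP[A + ->] /imsetP[B + ->]; rewrite !powersetE => AW BW.
apply/imsetP; exists (symd B A).
  rewrite powersetE symd_sub //.
    by apply: subset_trans BW _; rewrite setCS defW subsetUl.
  by apply: subset_trans AW _; rewrite -disjoints_subset disjoint_sym.
rewrite odd_nbr_symd defW; apply/setP => v; rewrite !inE !negbK.
case: (boolP (v \in W1)) => [vW|]; last by rewrite andbF.
by rewrite (disjointFr dW vW) /= andbT.
Qed.

Definition node_val b a1 a2 :=
  comb (best W1 a1 (symd b a2 :&: W1)) (best W2 a2 (symd b a1 :&: W2)).

(** A partial solution splits into its parts in [W1] and [W2], whose traces occur among the listed
    triples; since the key contains [b'], the outer maximum only counts at [b' = b]. *)
Lemma best_node a b : b \in cut_space G (~: W) ->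
  best W a b =
  \max_(b' <- cut_seq G (~: W)) \max_(a1 <- cut_seq G W1)
    \max_(a2 <- cut_seq G W2)
    if key (symd a1 a2 :\: W) b' == key a b then node_val b' a1 a2 else 0.
Proof.
move=> bW; apply/eqP; rewrite eqn_leq; apply/andP; split.
  apply/bigmax_leqP => S /[dup] HS /and3P[SW /eqP aS _].
  pose S1 := S :&: W1; pose S2 := S :&: W2.
  have defS : S = S1 :|: S2 by rewrite -setIUr -defW (setIidPl SW).
  pose a1 := nb S1 :\: W1; pose a2 := nb S2 :\: W2.
  have S1W : S1 \subset W1 by exact: subsetIr.
  have S2W : S2 \subset W2 by exact: subsetIr.
  have dS : [disjoint S1 & S2] by apply: disjointWl S1W _; apply: disjointWr dW.
  have ha : symd a1 a2 :\: W = a.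
    rewrite -aS defS -(symd_disjoint dS) odd_nbr_symd defW.
    by apply/setP => v; rewrite !inE; case: (v \in W1); case: (v \in W2).
  have := HS; rewrite -ha {1}defS (partial_union b S1W S2W erefl erefl).
  move=> /andP[H1 H2].
  have a1W : a1 \in cut_seq G W1.
    by rewrite mem_cut_seq; apply: imset_f; rewrite powersetE.
  have a2W : a2 \in cut_seq G W2.
    by rewrite mem_cut_seq; apply: imset_f; rewrite powersetE.
  have bW' : b \in cut_seq G (~: W) by rewrite mem_cut_seq.
  apply: leq_trans (leq_bigmax_seq _ bW' isT).
  apply: leq_trans (leq_bigmax_seq _ a1W isT).
  apply: leq_trans (leq_bigmax_seq _ a2W isT).
  rewrite ha eqxx /node_val /comb.
  have := best_ge H1; have := best_ge H2; rewrite defS cardsU.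
  by case: (best W1 _ _) (best W2 _ _) => [|i] [|j] //=; lia.
(* Conversely, a nonzero [comb] means that both children have optimal partial solutions, and their
   union is one for the node. *)
apply/bigmax_leqP_seq => b' _ _; apply/bigmax_leqP_seq => a1 _ _.
apply/bigmax_leqP_seq => a2 _ _; case: ifP => //.
rewrite eq_key => /andP[/eqP <- /eqP ->]; rewrite /node_val /comb.
case: ifP => // /negbT; rewrite negb_or -!lt0n => /andP[].
move=> /best_attained[S1 H1 ->] /best_attained[S2 H2 ->] /=.
have /and3P[S1W /eqP e1 _] := H1; have /and3P[S2W /eqP e2 _] := H2.
have dS : [disjoint S1 & S2] by apply: disjointWl S1W _; apply: disjointWr dW.
have -> : #|S1| + #|S2|.+1 = #|S1 :|: S2|.+1.
  by rewrite cardsU disjoint_setI0 // cards0 subn0 addnS.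
by apply: best_ge; rewrite (partial_union b S1W S2W e1 e2) H1 H2.
Qed.

End Node.

(** Only [b] is confined to its cut space: for an [a] that is not realized both sides are 0. *)
Definition table_of W t := forall a b, b \in cut_space G (~: W) ->
  tlook t (key a b) = encode_nat (best W a b).

(** Follows a single key through a loop. The step may itself be a loop of this kind, so the lemma
    nests for the three levels. *)
Lemma tlook_foldl (X : eqType) (step : sexp -> X -> sexp) k (g : X -> nat) l :
  (forall t x m, x \in l -> tlook t k = encode_nat m ->
     tlook (step t x) k = encode_nat (maxn m (g x))) ->
  forall t m, tlook t k = encode_nat m ->
  tlook (foldl step t l) k = encode_nat (maxn m (\max_(x <- l) g x)).
Proof.
elim: l => [|x l IH] Hstep t m Ht; first by rewrite big_nil maxn0.
rewrite big_cons maxnA /=; apply: IH; last exact: Hstep (mem_head _ _) Ht.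
by move=> t' x' m' Hx'; apply: Hstep; rewrite inE Hx' orbT.
Qed.

Lemma lookup_table W t a b : table_of W t -> b \in cut_space G (~: W) ->
  runs fLookup (Cons t (encb (key a b))) (encode_nat (best W a b)) (60 * N).
Proof.
move=> Ht bW; rewrite -Ht //; apply: runs_weaken (lookup_runs _ _) _ _ => //.
by rewrite size_key; lia.
Qed.

Section NodeRuns.
Variables (W1 W2 : {set V}) (t1 t2 : sexp) (R : nat).
Hypothesis dW : [disjoint W1 & W2].
Hypotheses (Ht1 : table_of W1 t1) (Ht2 : table_of W2 t2).
Notation W := (symd W1 W2).
Notation R1 := (cut_seq G W1).
Notation R2 := (cut_seq G W2).
Notation C := (cut_seq G (~: W)).
Hypotheses (R_gt0 : 0 < R) (sR1 : size R1 <= R) (sR2 : size R2 <= R)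
  (sC : size C <= R).
Let E := Cons (Cons (enc W) (Cons (enc W1) (enc W2)))
              (Cons (Cons t1 t2) (Cons (encl R1) (encl R2))).

Definition step2 b a1 t a2 :=
  tupd t (key (symd a1 a2 :\: W) b) (encode_nat (node_val W1 W2 b a1 a2)).
Definition step1 b t a1 := foldl (step2 b a1) t R2.
Definition step0 t b := foldl (step1 b) t R1.

Lemma step2_runs b a1 a2 t : b \in C -> a1 \in R1 -> a2 \in R2 ->
  runs fStep2 (Cons (Cons (Cons E (enc b)) (enc a1)) (Cons t (enc a2)))
    (step2 b a1 t a2) (1000 * N).
Proof.
rewrite !mem_cut_seq => bC a1R a2R.
have L1 := lookup_table a1 Ht1 (cut_space_shift dW a2R bC).
have L2 : runs fLookup (Cons t2 (encb (key a2 (symd b a1 :&: W2))))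
    (encode_nat (best W2 a2 (symd b a1 :&: W2))) (60 * N).
  have dW' : [disjoint W2 & W1] by rewrite disjoint_sym.
  have bC' : b \in cut_space G (~: symd W2 W1) by rewrite symdC.
  exact: lookup_table Ht2 (cut_space_shift dW' a1R bC').
have b1 := best_le W1 a1 (symd b a2 :&: W1).
have b2 := best_le W2 a2 (symd b a1 :&: W2).
rewrite /E; ev_body step2_body => //=.
rewrite size_key /comb; move: b1 b2.
by move: (best _ _ _) (best _ _ _) #|V| => i j n; case: ifP => _; lia.
Qed.

Lemma loop2_runs b a1 t : b \in C -> a1 \in R1 ->
  runs fLoop2 (Cons (Cons (Cons E (enc b)) (enc a1)) (Cons t (encl R2)))
    (step1 b t a1) (2200 * (R * N)).
Proof.
move=> bC a1R.
have [||H _] := @fold_runs _ _ id (@enc V) fLoop2 fStep2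
  (Cons (Cons E (enc b)) (enc a1)) (step2 b a1) xpredT erefl (1000 * N) R2 t.
- by move=> t' a2 _ a2R; split=> //; apply: step2_runs.
- by [].
apply: runs_weaken H _ _ => //.
(* As [R] is positive, the extra round of the loop is absorbed by replacing [R] with [R + R]; the
   outer loops repeat this. *)
have : (size R2).+1 * (1000 * N + 30) <= (R + R) * (1100 * N).
  by apply: leq_mul; lia.
by move/leq_trans; apply; lia.
Qed.

Lemma loop1_runs b t : b \in C ->
  runs fLoop1 (Cons (Cons E (enc b)) (Cons t (encl R1)))
    (step0 t b) (4600 * (R * R * N)).
Proof.
move=> bC.
have RN : 0 < R * N by rewrite muln_gt0 R_gt0.
have [||H _] := @fold_runs _ _ id (@enc V) fLoop1 fStep1
  (Cons E (enc b)) (step1 b) xpredT erefl (2250 * (R * N)) R1 t.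
- move=> t' a1 _ a1R; split=> //; have L := loop2_runs t' bC a1R.
  by ev_body step1_body => //; lia.
- by [].
apply: runs_weaken H _ _ => //.
have : (size R1).+1 * (2250 * (R * N) + 30) <= (R + R) * (2300 * (R * N)).
  by apply: leq_mul; lia.
by move/leq_trans; apply; lia.
Qed.

Lemma loop0_runs :
  runs fLoop0 (Cons E (Cons Nil (encl C)))
    (foldl step0 Nil C) (10 * 1000 * (R * R * R * N)).
Proof.
have RN : 0 < R * R * N by rewrite !muln_gt0 R_gt0.
have [||H _] := @fold_runs _ _ id (@enc V) fLoop0 fStep0
  E step0 xpredT erefl (4650 * (R * R * N)) C Nil.
- move=> t' b _ bC; split=> //; have L := loop1_runs t' bC.
  by ev_body step0_body => //; lia.
- by [].
apply: runs_weaken H _ _ => //.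
have : (size C).+1 * (4650 * (R * R * N) + 30)
    <= (R + R) * (4700 * (R * R * N)).
  by apply: leq_mul; lia.
by move/leq_trans; apply; lia.
Qed.

Lemma loop0_table : table_of W (foldl step0 Nil C).
Proof.
move=> a b bW; rewrite (best_node dW a bW) -[X in encode_nat X]max0n.
apply: tlook_foldl; last by rewrite tlook_Nil.
move=> t b' m _ Hm; apply: tlook_foldl Hm => {t m} t a1 m _ Hm.
apply: tlook_foldl Hm => {t m} t a2 m _ Hm.
rewrite /step2 tlook_upd ?size_key //; case: ifP => _; last by rewrite maxn0.
by rewrite Hm smax_nat.
Qed.

End NodeRuns.
End DynamicProgram.

(** * The recursion over the decomposition tree *)

Section Solve.
Variables (V : finType) (G : sgraph V).
Implicit Types (A B S W X a b : {set V}) (T : leaf_tree V).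
Notation N := #|V|.+1.
Notation nb := (odd_nbr G).

Definition vset T : {set V} := [set v in leaves T].

(** A common bound for the span computations, of order [N * N * R], and the loop over triples, of
    order [R * R * R * N]. *)
Definition node_cost R := 20 * 1000 * (N * N * (R * R * R)).

(** The empty set has trace zero and tolerates both values of [b]; the set of [v] alone has trace
    [nbr G v] and needs [b] to be zero. For an isolated [v] two of the keys coincide, and the
    maximum keeps the larger entry. *)
Definition leaf_table (v : V) :=
  tupd (tupd (tupd Nil (key (set0 : {set V}) set0) (encode_nat 1))
    (key set0 [set v]) (encode_nat 1)) (key (nbr G v) set0) (encode_nat 2).

Lemma bits_set1 (v : V) :
  bits [set v] = set_nth false (bits (set0 : {set V})) (enum_rank v) true.
Proof.
have sz : enum_rank v < #|V| := ltn_ord _.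
apply: (@eq_from_nth _ false) => [|i].
  by rewrite size_set_nth !size_bits (maxn_idPr sz).
rewrite size_bits => Hi; rewrite nth_set_nth /= /bits.
have szi : i < size (enum V) by rewrite -cardE.
rewrite 2!(nth_map v _ _ szi) !inE.
have -> : nth v (enum V) i = enum_val (Ordinal Hi) by rewrite (enum_val_nth v).
by rewrite -(inj_eq enum_rank_inj) enum_valK -val_eqE /=; case: eqP.
Qed.

Lemma leaf_runs (v : V) :
  runs fSolve (Cons (encode_graph G) (encode_tree (Leaf v)))
    (Cons (enc [set v]) (leaf_table v)) (1000 * N).
Proof.
have i_lt : enum_rank v < #|V| := ltn_ord _.
have Hn : runs fNth (Cons (encode_graph G) (encode_nat (enum_rank v)))
    (enc (nbr G v)) (20 * N).
  rewrite encode_graphE; apply: runs_weaken (nth_runs _ _) _ _; last by lia.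
  rewrite -map_comp (nth_map v) -?cardE //=.
  by rewrite nth_enum_rank.
have Hz : runs fDiff (Cons (enc (nbr G v)) (enc (nbr G v)))
    (enc (set0 : {set V})) (40 * N).
  by rewrite -(setDv (nbr G v)); exact: diff_runs.
have Hs : runs fSetBit (Cons (enc (set0 : {set V})) (encode_nat (enum_rank v)))
    (enc [set v]) (20 * N).
  rewrite /enc bits_set1; apply: runs_weaken (setbit_runs _) _ _ => //.
    by rewrite size_bits.
  by lia.
have U t A B j : runs fUpdate (Cons t (Cons (encb (key A B)) (encode_nat j)))
    (tupd t (key A B) (encode_nat j)) (80 * N + 20 * j.+1).
  apply: runs_weaken (update_runs _ _ _) _ _ => //.
  by rewrite size_key; lia.
have U1 t A B := U t A B 1.
have U2 t A B := U t A B 2.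
ev_body solve_body => //=.
by lia.
Qed.

(** The hypothesis confines [b] to the singleton of [v]. As [v] is not its own neighbour, the parity
    condition at [v] then says that [b] is empty. *)
Lemma partial_set1 (v : V) a b S : b \in cut_space G (~: [set v]) ->
  partial G [set v] a b S =
  (S == set0) && (a == set0) ||
  (S == [set v]) && (a == nbr G v) && (b == set0).
Proof.
case/imsetP => X _ ->; rewrite setDE setCK; set b' := _ :&: _.
have vN : v \notin nbr G v by rewrite inE adj_irrefl.
rewrite /partial subset1 andb_orl orbC; congr orb.
  case: eqP => [->|] //=; rewrite odd_nbr0 set0D !set0I eqxx andbT.
  by rewrite eq_sym.
case: eqP => [->|] //=; rewrite odd_nbr1 eq_sym.
have -> : nbr G v :\: [set v] = nbr G v.
  by apply/setDidPl; rewrite disjoint_sym disjoints1.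
congr andb.
have -> : [set v] :&: nbr G v = set0.
  by apply: disjoint_setI0; rewrite disjoints1.
by rewrite /b' setIC -setIA setIid eq_sym setIC.
Qed.

Lemma bigmax_orb (I : finType) (P Q : pred I) (F : I -> nat) :
  \max_(i | P i || Q i) F i = maxn (\max_(i | P i) F i) (\max_(i | Q i) F i).
Proof.
apply/eqP; rewrite eqn_leq geq_max; apply/and3P; split; apply/bigmax_leqP => i.
- by case/orP => Hi; rewrite leq_max;
    [rewrite (bigmax_sup i)|rewrite orbC (bigmax_sup i)].
- by move=> Pi; apply: (bigmax_sup i) => //; rewrite Pi.
- by move=> Qi; apply: (bigmax_sup i) => //; rewrite Qi orbT.
Qed.

Lemma bigmax_eq_op (I : finType) (x : I) c (F : I -> nat) :
  \max_(i | (i == x) && c) F i = if c then F x else 0.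
Proof.
case: c; first by under eq_bigl do rewrite andbT; rewrite big_pred1_eq.
by rewrite big_pred0 // => i; rewrite andbF.
Qed.

Lemma leaf_tableP (v : V) : table_of G [set v] (leaf_table v).
Proof.
move=> a b bW; rewrite /leaf_table !tlook_upd ?size_key // !eq_key.
rewrite tlook_Nil.
pose m0 := if (set0 == a) && (set0 == b) then 1 else 0.
pose m1 := if (set0 == a) && ([set v] == b) then maxn m0 1 else m0.
pose m2 := if (nbr G v == a) && (set0 == b) then maxn m1 2 else m1.
transitivity (encode_nat m2).
  rewrite /m2 /m1 /m0; do 3 case: ifP => _ //=; rewrite ?smax_nat //.
congr encode_nat; rewrite /best.
under eq_bigl do rewrite partial_set1 //.
(* Only these two values of [b] have to agree with the table. *)
have b01 : b = set0 \/ b = [set v].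
  case/imsetP: bW => X _ ->; rewrite setDE setCK.
  have : nb X :&: [set v] \subset [set v] by exact: subsetIr.
  by rewrite subset1 => /orP[/eqP->|/eqP->]; [right|left].
rewrite bigmax_orb.
under [X in maxn _ X]eq_bigl do rewrite -andbA.
rewrite !bigmax_eq_op cards0 cards1 /m2 /m1 /m0.
rewrite !(eq_sym _ a) ![set0 == b]eq_sym.
have v0 : ([set v] == set0) = false.
  by apply/negP => /eqP/setP/(_ v); rewrite !inE eqxx.
case: b01 => ->; rewrite eqxx ?v0 ?[set0 == _]eq_sym ?v0 ?andbT ?andbF.
  by case: (a == set0); case: (a == nbr G v).
by case: (a == set0).
Qed.

(** * Even induced subgraphs as the root entry *)

Lemma degree_induced S (x : {x | x \in S}) :
  degree (induced G S) x = #|[set u in S | G u (val x)]|.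
Proof.
rewrite /degree -(card_imset _ val_inj); congr (#|pred_of_set _|).
apply/setP => u; rewrite inE; apply/imsetP/andP => [[y]|[uS Gu]].
  by rewrite inE /= /induced_adj adj_sym => Gy ->; split=> //; exact: valP.
by exists (Sub u uS); rewrite ?inE /= /induced_adj ?SubK // adj_sym.
Qed.

(** Nothing lies outside [setT], so both traces vanish and what remains is that no vertex of [S] has
    an odd number of neighbours in [S]. *)
Lemma even_partial S : even_graph (induced G S) = partial G setT set0 set0 S.
Proof.
rewrite /partial subsetT setDT eqxx setI0 /=.
apply/forallP/eqP => [H|/setP H v].
  apply/setP => v; rewrite !inE; apply/negP => /andP[vS].
  by have := H (Sub v vS); rewrite degree_induced SubK => /negPf ->.
rewrite degree_induced; have := H (val v); rewrite !inE (valP v) /=.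
by move=> ->.
Qed.

Lemma best_root : best G setT set0 set0 = (max_even_subgraph G).+1.
Proof.
rewrite /best /max_even_subgraph; apply/eqP; rewrite eqn_leq; apply/andP; split.
  apply/bigmax_leqP => S HS; rewrite ltnS; apply: (bigmax_sup S) => //.
  by rewrite even_partial.
(* The empty set is feasible, so the maximum is attained. *)
have [|S HS ->] := @eq_bigmax_cond _ (fun S => even_graph (induced G S))
  (fun S => #|S|).
  apply/card_gt0P; exists set0; rewrite -topredE /= even_partial.
  by rewrite /partial sub0set odd_nbr0 set0D !set0I !eqxx.
by apply: (bigmax_sup S); rewrite // -even_partial.
Qed.

Lemma vset_node T1 T2 : uniq (leaves (Node T1 T2)) ->
  [disjoint vset T1 & vset T2] /\ vset (Node T1 T2) = symd (vset T1) (vset T2).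
Proof.
rewrite /= cat_uniq => /and3P[_ /hasPn dT _].
have d : [disjoint vset T1 & vset T2].
  apply/pred0P => v; rewrite /= !inE; apply/negP => /andP[v1 /dT].
  by rewrite /= v1.
by split=> //; rewrite symd_disjoint //; apply/setP => v; rewrite !inE mem_cat.
Qed.

(** One bound [k] for all ranks below gives each node the same cost, so the costs of the recursive
    calls simply add up. *)
Lemma solve_runs T k : uniq (leaves T) -> rank_width G T <= k ->
  exists2 t, table_of G (vset T) t &
    runs fSolve (Cons (encode_graph G) (encode_tree T)) (Cons (enc (vset T)) t)
      (size (subtrees T) * node_cost (2 ^ k)).
Proof.
elim: T => [v|T1 IH1 T2 IH2].
  move=> _ _; exists (leaf_table v).
    have -> : vset (Leaf v) = [set v] by apply/setP => u; rewrite !inE.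
    exact: leaf_tableP.
  have -> : vset (Leaf v) = [set v] by apply/setP => u; rewrite !inE.
  apply: runs_weaken (leaf_runs v) _ _ => //; rewrite /node_cost /= mul1n.
  have R0 : 0 < 2 ^ k * 2 ^ k * 2 ^ k by rewrite !muln_gt0 expn_gt0.
  have : N * 1 <= N * (N * (2 ^ k * 2 ^ k * 2 ^ k)).
    by rewrite leq_mul2l /= muln_gt0.
  by rewrite muln1 mulnA; clear; move: #|V| (N * N * _) => n M; lia.
move=> uT; have [dT defW] := vset_node uT.
have /andP[u1 u2] : uniq (leaves T1) && uniq (leaves T2).
  by move: uT; rewrite /= cat_uniq => /and3P[-> _ ->].
rewrite /rank_width /= big_cons big_cat !geq_max => /and3P[rk rk1 rk2].
have [t1 Ht1 run1] := IH1 u1 rk1; have [t2 Ht2 run2] := IH2 u2 rk2.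
have rkW T : rank_width G T <= k -> \rank (cut_matrix G (vset T)) <= k.
  by apply: leq_trans; case: T => *; rewrite /rank_width /= big_cons leq_maxl.
have {}rk1 := rkW _ rk1; have {}rk2 := rkW _ rk2.
(* The lists for [a1] and [a2] are bounded by the ranks at the children, the list for [b] by the
   rank at the node itself, seen from the other side of the cut. *)
have [u1' u2' uC] : [/\ #|cut_space G (vset T1)| <= 2 ^ k,
    #|cut_space G (vset T2)| <= 2 ^ k &
    #|cut_space G (~: symd (vset T1) (vset T2))| <= 2 ^ k].
  rewrite -defW; split.
  - by apply: leq_trans (card_cut_space _ _) _; rewrite leq_pexp2l.
  - by apply: leq_trans (card_cut_space _ _) _; rewrite leq_pexp2l.
  - by apply: leq_trans (card_cut_spaceC _ _) _; rewrite leq_pexp2l.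
move: (2 ^ k) (expn_gt0 2 k) u1' u2' uC run1 run2.
move=> R /= R0 u1' u2' uC run1 run2.
have span_R W : #|cut_space G W| <= R ->
    runs fCutSpan (Cons (encode_graph G) (enc W)) (encl (cut_seq G W))
      (800 * (N * N * R)) /\ size (cut_seq G W) <= R.
  move=> uW; split; last exact: leq_trans (size_cut_seq _ _) uW.
  apply: runs_weaken (cutspan_runs _ _) _ _ => //.
  by rewrite leq_mul2l leq_mul2l uW !orbT.
have [c1 s1] := span_R _ u1'; have [c2 s2] := span_R _ u2'.
have [cC sC] := span_R _ uC.
have L := loop0_runs dT Ht1 Ht2 R0 s1 s2 sC.
rewrite defW; eexists; first exact: loop0_table.
ev_body solve_body => //=.
rewrite size_cat /node_cost.
have h1 : N * N * R <= N * N * (R * R * R).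
  by rewrite leq_mul2l leq_pmull ?muln_gt0 ?R0 // orbT.
have h2 : R * R * R * N <= N * N * (R * R * R).
  by rewrite mulnC leq_mul2r leq_pmulr ?orbT.
have h3 : N <= R * R * R * N by rewrite leq_pmull // !muln_gt0 R0.
move: h1 h2 h3; clear.
move: (size _) (size _) (N * N * R) (R * R * R * N) (N * N * _).
by move: #|V| => n p q x y z; lia.
Qed.

Lemma main_runs T : is_decomposition_tree T ->
  runs 0 (encode_instance G T) (encode_nat (max_even_subgraph G))
    (size (subtrees T) * node_cost (2 ^ rank_width G T) + 400 * N).
Proof.
move=> [uT allT]; have [t Ht run] := solve_runs uT (leqnn _).
have vT : vset T = setT by apply/setP => v; rewrite !inE allT.
rewrite vT in run Ht.
have Hz : runs fDiff (Cons (enc (setT : {set V})) (enc (setT : {set V})))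
    (enc (set0 : {set V})) (40 * N) by rewrite -(setDv setT); exact: diff_runs.
have Hl := lookup_table set0 Ht (cut_space0 _ _).
rewrite best_root in Hl.
ev_body main_body => //=.
by move: #|V| (size _ * _) => n s; lia.
Qed.

End Solve.

(** * The bound in terms of the input size *)

Lemma sexp_size_encode_seq s : size s < sexp_size (encode_seq s).
Proof. by elim: s => //= x s IH; lia. Qed.

Lemma size_subtrees (V : finType) (T : leaf_tree V) :
  size (subtrees T) <= sexp_size (encode_tree T).
Proof. by elim: T => [v|l IHl r IHr] //=; rewrite size_cat; lia. Qed.

Theorem theorem5 :
  exists (p : program) (c d : nat),
    forall (V : finType) (G : sgraph V) (T : leaf_tree V),
      is_decomposition_tree T ->
      exists t : nat,
        computes_in p (encode_instance G T)
          (encode_nat (max_even_subgraph G)) t /\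
        t <= c * sexp_size (encode_instance G T) ^ d
             * 2 ^ (3 * rank_width G T).
Proof.
(* The exponent 3 counts one factor for the number of nodes and two for [N * N] in [node_cost]. The
   constant is that of [node_cost], enlarged to absorb the final lookup. *)
exists prog, (21 * 1000), 3 => V G T /main_runs -/(_ G)[t run le_t].
exists t; split=> //; apply: leq_trans le_t _.
have M1 : #|V|.+1 <= sexp_size (encode_instance G T).
  have := sexp_size_encode_seq
    [seq encode_seq [seq encode_bool (G u v) | v <- enum V] | u <- enum V].
  rewrite size_map -cardE => /leq_trans; apply.
  by rewrite /= -addSn leqW // leq_addr.
have M2 : size (subtrees T) <= sexp_size (encode_instance G T).
  by apply: leq_trans (size_subtrees T) _; rewrite /= leqW // leq_addl.
rewrite mulnC (mulnC 3) expnM; move: M1 M2.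
rewrite /node_cost !expnS !expn0 !muln1.
have := expn_gt0 2 (rank_width G T); have := ltn0Sn #|V|.
move: (sexp_size _) #|V|.+1 (size _) (2 ^ _) => M N s R N_gt0 R_gt0 NM sM.
have M_gt0 : 0 < M := leq_trans N_gt0 NM.
have h1 : s * (N * N * (R * R * R)) <= M * (M * M * (R * R * R)).
  by rewrite !leq_mul.
have h2 : N <= M * (M * M * (R * R * R)).
  by apply: leq_trans NM _; rewrite leq_pmulr // !muln_gt0 R_gt0 M_gt0.
by move: h1 h2; lia.
Qed.
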